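(* Let $\mathcal{G}$ be a finite abelian group of order $f\geq 2$, let $v>k\geq 2$ be integers, and let $\Phi(z)$ be a polyphase matrix over $\mathcal{G}$ whose entries are either monomials over $\mathcal{G}$ or zero, with the property that $X=|\Phi(z)|^2$ is the ($b\times v$) incidence matrix of a $\mathrm{BIBD}(v,k,1)$. Let $r:=\frac{v-1}{k-1}$, let $\mathbf{1}(z):=\sum_{g\in\mathcal{G}}z^g$, let $\Phi(z;i,j)$ denote the $(i,j)$th entry of $\Phi(z)$, and let $J$ be the $b\times v$ all-ones matrix. The following are equivalent: (i) $\Phi(z)$ is a $(v,k,f)$-polyphase BIBD ETF; (ii) $\Phi(z)\Phi^*(z)\Phi(z)=(r+k-1)\Phi(z)+\tfrac kf\mathbf{1}(z)(J-X)$; (iii) $\displaystyle\sum_{i'=1}^{b}\sum_{j'=1}^{v}\Phi(z;i,j')\overline{\Phi(z;i',j')}\Phi(z;i',j)=\tfrac kf\mathbf{1}(z)$ for all $i$ and $j$ such that $\Phi(z;i,j)=0$; (iv) for all $i$ and $j$ such that $\Phi(z;i,j)=0$, the cardinality of $$\{(i',j'): z^g=\Phi(z;i,j')\overline{\Phi(z;i',j')}\Phi(z;i',j)\}$$ is constant over all $g\in\mathcal{G}$. In this case, $f$ necessarily divides $k$, and $A(z)=\Phi^*(z)\Phi(z)-rI$ is an abelian $(v,f,c)$-DRACKN with $c=\frac{k(r-1)}{f}$. Moreover, if (i)--(iv) hold and $f$ is even, then a nontrivial character $\gamma$ of $\mathcal{G}$ can be chosen so that $\Phi(\gamma)$ is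 real (so that its columns form a real ETF for their span).
   Context: **Polyphase matrices.** For a finite abelian group $\mathcal{G}$ (written additively), elements of the group ring $\mathbb{C}\mathcal{G}$ are written as formal polynomials $x(z)=\sum_{g\in\mathcal{G}}x(g)z^g$ with $x(g)\in\mathbb{C}$, multiplied by $z^{g_1}z^{g_2}=z^{g_1+g_2}$; the multiplicative identity is $1=z^0$. A monomial over $\mathcal{G}$ is an element $z^g$, $g\in\mathcal{G}$. The conjugate of $x(z)$ is $\overline{x(z)}:=\sum_{g}\overline{x(-g)}z^g$. A polyphase matrix over $\mathcal{G}$ is a matrix with entries in $\mathbb{C}\mathcal{G}$; $\Phi^*(z)$ is the matrix whose $(j,i)$ entry is the conjugate of the $(i,j)$ entry of $\Phi(z)$, and self-adjoint means $A^*(z)=A(z)$. $|\Phi(z)|^2$ is the matrix whose $(i,j)$ entry is $\overline{x(z)}x(z)$, where $x(z)$ is the $(i,j)$ entry of $\Phi(z)$ (so monomial entries give $1$ and zero entries give $0$). Scalar matrices such as $I$, $J$, $X$ are regarded as polyphase matrices with constant entries (multiples of $1=z^0$). A character of $\mathcal{G}$ is a homomorphism $\gamma:\mathcal{G}\to\{\zeta\in\mathbb{C}:|\zeta|=1\}$; $x(\gamma):=\sum_g x(g)\gamma(g)$, and $\Phi(\gamma)$ is the complex matrix obtained by applying this to every entry of $\Phi(z)$. **BIBD.** For integers $v>k\geq 2$, a $\mathrm{BIBD}(v,k,1)$ is a $v$-element vertex set with a collection of $b$ subsets (blocks) such that every block contains exactly $k$ vertices and every pair of distinct vertices is in exactly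 one block. Its incidence matrix is the $b\times v$ $\{0,1\}$-matrix with rows indexed by blocks, columns by vertices, and entry $1$ iff the vertex lies in the block. **ETF.** Vectors $\varphi_1,\dots,\varphi_n\in\mathbb{C}^m$ form an equiangular tight frame (ETF) for their span $H$ if they are nonzero with equal norms, there is $w$ with $|\langle\varphi_i,\varphi_j\rangle|=w$ for all $i\neq j$, and there is $a>0$ with $\sum_i\langle\varphi_i,x\rangle\varphi_i=ax$ for all $x\in H$ (inner product conjugate-linear in the first argument). **Polyphase BIBD ETF.** Let $\mathcal{G}$ be an abelian group of order $f$. A polyphase matrix $\Phi(z)$ whose entries are monomials over $\mathcal{G}$ or zero is a $(v,k,f)$-polyphase BIBD ETF if $|\Phi(z)|^2$ is the incidence matrix of a $\mathrm{BIBD}(v,k,1)$ and, for all nontrivial characters $\gamma$ of $\mathcal{G}$, the columns of $\Phi(\gamma)$ form an ETF for their span. **Abelian DRACKN.** For positive integers $n,f,c$ with $f\geq 2$ and an abelian group $\mathcal{G}$ of order $f$, an abelian $(n,f,c)$-DRACKN is a self-adjoint $n\times n$ polyphase matrix $A(z)$ over $\mathcal{G}$ whose diagonal entries are zero, whose off-diagonal entries are monomials, and which satisfies $[A(z)]^2=(n-fc-2)A(z)+(n-1)I+c\,\mathbf{1}(z)(J-I)$, where $\mathbf{1}(z)=\sum_{g\in\mathcal{G}}z^g$ and here $J$ is the $n\times n$ all-ones matrix. *)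

(* Defs.v *)
From HB Require Import structures.
From mathcomp Require Import all_boot all_order all_algebra.

Set Implicit Arguments.
Unset Strict Implicit.
Unset Printing Implicit Defensive.

Import Order.TTheory GRing.Theory Num.Theory.
Local Open Scope ring_scope.

(** The group algebra of a finite abelian group [G] (written additively).
    It is an alias of [{ffun G -> C}], needed because [{ffun G -> C}] itself
    carries the pointwise product, whereas the product here is convolution. *)
Definition grpalg (C : comNzRingType) (G : finZmodType) : Type :=
  {ffun G -> C}.

Section GroupAlgebra.
Variables (C : comNzRingType) (G : finZmodType).
Local Notation A := (grpalg C G).
Implicit Types (x y z : A) (g h : G).

HB.instance Definition _ := GRing.Lmodule.copy A {ffun G -> C^o}.

(** [zmon g] is the monomial z^g. *)
Definition zmon g : A := [ffun h => (h == g)%:R].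

Definition grpalg_mul x y : A := [ffun g => \sum_(h : G) x h * y (g - h)].

Fact grpalg_mulC : commutative grpalg_mul.
Proof.
move=> x y; apply/ffunP => g; rewrite !ffunE.
rewrite (reindex_inj (inv_inj (subKr g))) /=.
by apply: eq_bigr => h _; rewrite subKr mulrC.
Qed.

Fact grpalg_mulA : associative grpalg_mul.
Proof.
move=> x y z; apply/ffunP => g; rewrite !ffunE.
under eq_bigr => h _ do rewrite ffunE big_distrr /=.
under [RHS]eq_bigr => h _ do rewrite ffunE big_distrl /=.
rewrite [RHS]exchange_big /=; apply: eq_bigr => h _.
rewrite [RHS](reindex_inj (addIr h)) /=; apply: eq_bigr => l _.
by rewrite addrK mulrA opprD [- l - h]addrC addrA.
Qed.

Fact grpalg_mul1 : left_id (zmon 0) grpalg_mul.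
Proof.
move=> x; apply/ffunP => g; rewrite ffunE (bigD1 0) //= ffunE eqxx mul1r subr0.
rewrite big1 ?addr0 // => h /negbTE h0.
by rewrite ffunE h0 mul0r.
Qed.

Fact grpalg_mulDl : left_distributive grpalg_mul +%R.
Proof.
move=> x y z; apply/ffunP => g; rewrite !ffunE -big_split /=.
by apply: eq_bigr => h _; rewrite ffunE mulrDl.
Qed.

Fact grpalg_1neq0 : zmon 0 != 0 :> A.
Proof.
by apply/eqP => /ffunP/(_ 0)/eqP; rewrite !ffunE eqxx oner_eq0.
Qed.

HB.instance Definition _ := GRing.Zmodule_isComNzRing.Build A
  grpalg_mulA grpalg_mulC grpalg_mul1 grpalg_mulDl grpalg_1neq0.

Fact grpalg_scaleAl (a : C) x y : a *: (x * y) = (a *: x) * y.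
Proof.
apply/ffunP => g; rewrite !ffunE.
by rewrite scaler_sumr; apply: eq_bigr => h _; rewrite ffunE scalerAl.
Qed.

HB.instance Definition _ := GRing.Lmodule_isLalgebra.Build C A grpalg_scaleAl.
HB.instance Definition _ := GRing.Lalgebra_isComAlgebra.Build C A.

Lemma zmonD g h : zmon (g + h) = zmon g * zmon h.
Proof.
apply/ffunP => l; rewrite !ffunE (bigD1 g) //= !ffunE eqxx mul1r big1 ?addr0.
  by rewrite subr_eq addrC.
by move=> m /negbTE mg; rewrite ffunE mg mul0r.
Qed.

Definition is_zmon x : Prop := exists g, x = zmon g.

(** The element 1(z) = \sum_g z^g; not to be confused with the unit
    [1 = zmon 0] of the algebra. *)
Definition zsum : A := \sum_(g : G) zmon g.

Definition zeval (gamma : G -> C) x : C := \sum_(g : G) x g * gamma g.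

End GroupAlgebra.

Section Polyphase.
Variables (C : numClosedFieldType) (G : finZmodType).
Local Notation A := (grpalg C G).

Definition zconj (x : A) : A := [ffun g => (x (- g))^*].

Lemma zconj_zmon (g : G) : zconj (zmon C g) = zmon C (- g).
Proof. by apply/ffunP => h; rewrite !ffunE eqr_oppLR rmorph_nat. Qed.

Definition padj (m n : nat) (Phi : 'M[A]_(m, n)) : 'M[A]_(n, m) :=
  (map_mx zconj Phi)^T.

Definition abs2mx (m n : nat) (Phi : 'M[A]_(m, n)) : 'M[A]_(m, n) :=
  map_mx (fun x => zconj x * x) Phi.

Definition peval (gamma : G -> C) (m n : nat) (Phi : 'M[A]_(m, n)) :
    'M[C]_(m, n) :=
  map_mx (zeval gamma) Phi.

Definition is_character (gamma : G -> C) : Prop :=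
  {morph gamma : g h / g + h >-> g * h} /\ (forall g, `|gamma g| = 1).

Definition nontrivial_character (gamma : G -> C) : Prop :=
  is_character gamma /\ exists g, gamma g != 1.

Definition monomial_or_zero (m n : nat) (Phi : 'M[A]_(m, n)) : Prop :=
  forall i j, Phi i j = 0 \/ is_zmon (Phi i j).

End Polyphase.

(** The vertex set is ['I_v], and [B i] is the [i]th of the [b] blocks. *)
Definition is_BIBD1 (b v k : nat) (B : 'I_b -> {set 'I_v}) : Prop :=
  [/\ (2 <= k)%N, (k < v)%N, (forall i, #|B i| = k) &
      forall j1 j2 : 'I_v, j1 != j2 ->
        #|[set i : 'I_b | (j1 \in B i) && (j2 \in B i)]| = 1%N].

Definition is_BIBD1_incidence (A : nzRingType) (b v k : nat)
    (X : 'M[A]_(b, v)) : Prop :=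
  exists2 B : 'I_b -> {set 'I_v},
    is_BIBD1 k B & X = \matrix_(i, j) (j \in B i)%:R.

Section ETF.
Variable C : numClosedFieldType.

Definition inner (m : nat) (x y : 'cV[C]_m) : C := \sum_i (x i 0)^* * y i 0.

Definition vnorm (m : nat) (x : 'cV[C]_m) : C := sqrtC (inner x x).

Definition is_ETF (m n : nat) (phi : 'I_n -> 'cV[C]_m) : Prop :=
  [/\ (forall i, phi i != 0),
      (forall i j, vnorm (phi i) = vnorm (phi j)),
      (exists w : C, forall i j, i != j -> `|inner (phi i) (phi j)| = w) &
      exists2 a : C, 0 < a &
        forall x, x \in <<codom phi>>%VS ->
          \sum_i inner (phi i) x *: phi i = a *: x].

Definition columns_ETF (m n : nat) (M : 'M[C]_(m, n)) : Prop :=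
  is_ETF (fun j => col j M).

End ETF.

Definition is_polyphase_BIBD_ETF (C : numClosedFieldType) (G : finZmodType)
    (b v k f : nat) (Phi : 'M[grpalg C G]_(b, v)) : Prop :=
  [/\ #|G| = f, monomial_or_zero Phi, is_BIBD1_incidence k (abs2mx Phi) &
      forall gamma : G -> C, nontrivial_character gamma ->
        columns_ETF (peval gamma Phi)].

Definition is_abelian_DRACKN (C : numClosedFieldType) (G : finZmodType)
    (n f c : nat) (A : 'M[grpalg C G]_n) : Prop :=
  [/\ [/\ (0 < n)%N, (2 <= f)%N, (0 < c)%N & #|G| = f],
      padj A = A,
      (forall i, A i i = 0),
      (forall i j, i != j -> is_zmon (A i j)) &
      A *m A = (n%:R - f%:R * c%:R - 2%:R) *: A + (n%:R - 1)%:M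
               + (c%:R * zsum C G) *: (const_mx 1 - 1%:M)].

(* Main.v *)
(** An element of C[G] is determined by its values at all characters, and it is
    a multiple of 1(z) exactly when it vanishes at the nontrivial ones.  The
    block design alone forces (Phi Phi^* Phi)(i, j) = (r + k - 1) Phi(i, j)
    whenever Phi(i, j) != 0, because two distinct blocks share at most one
    vertex; and the Gram matrix Phi^* Phi always has diagonal r and monomial
    off-diagonal entries.  So the columns of Phi(gamma) form an ETF for every
    nontrivial gamma exactly when the remaining entries of Phi Phi^* Phi are
    multiples of 1(z), and the trivial character, which counts k triples,
    determines the multiple as k / f. *)
Require Import Defs.
From mathcomp Require Import all_boot all_order all_algebra.
From mathcomp Require Import fingroup cyclic pgroup finalg separable cyclotomic.
From mathcomp Require Import boolp reals complex ring.

Set Implicit Arguments.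
Unset Strict Implicit.
Unset Printing Implicit Defensive.

Import Order.TTheory GRing.Theory Num.Theory.
Local Open Scope ring_scope.

(** * Characters of a finite abelian group and their separation of group algebra elements *)

Section Characters.
Variables (C : numClosedFieldType) (G : finZmodType).
Implicit Types (gamma : G -> C) (x y : grpalg C G) (g h : G).

Lemma mulrn_card g : g *+ #|G| = 0.
Proof.
by rewrite -FinRing.zmodXgE -cardsT expg_cardG ?inE.
Qed.

(** In characteristic zero ['X^n - 1] is separable, so its roots are simple. This polynomial will
    annihilate the translation operators. *)
Lemma Xn_sub_1_split n : (0 < n)%N ->
  exists2 rs : seq C, uniq rs & 'X^n - 1 = \prod_(x <- rs) ('X - x%:P).
Proof.
move=> n_gt0; have [rs Drs] := closed_field_poly_normal ('X^n - 1 : {poly C}).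
move: Drs; rewrite (monicP (monic_Xn_sub_1 C n_gt0)) scale1r => Drs.
exists rs => //; rewrite -separable_prod_XsubC -Drs.
by rewrite separable_Xn_sub_1 // pnatr_eq0 -lt0n.
Qed.

Lemma character0 gamma : is_character gamma -> gamma 0 = 1.
Proof.
case=> gD g1; have /eqP := gD 0 0; rewrite addr0 -subr_eq0 -{1}[gamma 0]mulr1.
have g0 : gamma 0 != 0 by rewrite -normr_eq0 g1 oner_eq0.
by rewrite -mulrBr mulf_eq0 (negbTE g0) subr_eq0 eq_sym => /eqP.
Qed.

Lemma characterN gamma g : is_character gamma -> gamma (- g) = (gamma g)^*.
Proof.
move=> gc; have [gD g1] := gc.
have g0 : gamma g != 0 by rewrite -normr_eq0 g1 oner_eq0.
apply: (mulfI g0); rewrite -gD subrr character0 // -normCK g1 expr1n //.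
Qed.

(** One nonzero value forces [gamma 0 = 1]; every value is then a [#|G|]-th root of unity and so has
    modulus 1. *)
Lemma morph_character gamma : {morph gamma : g h / g + h >-> g * h} ->
  (exists g, gamma g != 0) -> is_character gamma.
Proof.
move=> gD [g0 g0P]; split=> // g.
have gam0 : gamma 0 = 1.
  by apply: (mulfI g0P); rewrite -gD addr0 mulr1.
have gX n : gamma (g *+ n) = gamma g ^+ n.
  by elim: n => [|n IHn]; rewrite ?gam0 // mulrS exprS gD IHn.
have cG : (0 < #|G|)%N by apply/card_gt0P; exists 0.
apply/eqP; rewrite -(@pexpr_eq1 _ _ #|G|) //.
by rewrite -normrX -gX mulrn_card gam0 normr1.
Qed.

Section Translations.
Variables (n : nat) (e : 'I_n.+1 -> G) (e' : G -> 'I_n.+1).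
Hypotheses (eK : cancel e e') (e'K : cancel e' e).

(** The regular representation of [G] in the enumeration [e]. The size is a successor so that square
    matrices form a ring, with powers and minimal polynomials. *)
Definition translation_mx g : 'M[C]_n.+1 := \matrix_(i, j) (e j + g == e i)%:R.

Lemma mul_row_translation_mx m (P : 'M[C]_(m, n.+1)) g i h :
  (P *m translation_mx g) i (e' h) = P i (e' (h + g)).
Proof.
rewrite mxE (bigD1 (e' (h + g))) //= mxE !e'K eqxx mulr1 big1 ?addr0 // => j nj.
rewrite mxE e'K; case: eqP => [Dj|]; last by rewrite mulr0.
by rewrite Dj eK eqxx in nj.
Qed.

Lemma translation_mxD g h :
  translation_mx (g + h) = translation_mx g *m translation_mx h.
Proof.
apply/matrixP => i j; rewrite -(eK j) mul_row_translation_mx !mxE !e'K.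
by rewrite addrAC addrA.
Qed.

Lemma translation_mx0 : translation_mx 0 = 1%:M.
Proof.
by apply/matrixP => i j; rewrite !mxE addr0 (can_eq eK) eq_sym.
Qed.

Lemma translation_mxX g m : translation_mx (g *+ m) = translation_mx g ^+ m.
Proof.
elim: m => [|m IHm]; first exact: translation_mx0.
by rewrite mulrS exprS translation_mxD IHm.
Qed.

(** The order of [g] divides [#|G|], so the minimal polynomial divides ['X^#|G| - 1], which splits
    with simple roots. *)
Lemma diagonalizable_translation_mx g : diagonalizable (translation_mx g).
Proof.
have cG : (0 < #|G|)%N by apply/card_gt0P; exists 0.
apply/diagonalizableP; have [rs urs Drs] := Xn_sub_1_split cG.
exists rs => //; rewrite -Drs; apply: mxminpoly_min.
rewrite rmorphB rmorphXn rmorph1 /= horner_mx_X -translation_mxX mulrn_card.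
by rewrite translation_mx0 subrr.
Qed.

(** The translations commute and are diagonalizable, hence some invertible [P] diagonalizes them
    all. Each row of [P], read as a function on [G], is a common eigenvector and therefore a
    multiple of a character. *)
Lemma zeval_eq0_enum x :
  (forall gamma, is_character gamma -> zeval gamma x = 0) ->
  x = 0.
Proof.
move=> x0.
have /codiagonalizableP[P Punit /allP Pdiag] :
    {in [seq translation_mx g | g : G] &, forall A B, comm_mx A B} /\
    {in [seq translation_mx g | g : G], forall A, diagonalizable A}.
  split=> [_ _ /mapP[g _ ->] /mapP[h _ ->]|_ /mapP[g _ ->]]; last first.
    exact: diagonalizable_translation_mx.
  by rewrite /comm_mx -!translation_mxD addrC.
(* [d i g] is the eigenvalue of translation by [g] on row [i], read off the diagonal of the
   conjugated matrix. *)
have [d Dd] : exists d : 'I_n.+1 -> G -> C,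
    forall i g h, P i (e' (h + g)) = d i g * P i (e' h).
  exists (fun i g => (P *m translation_mx g *m invmx P) i i) => i g h.
  have /Pdiag : translation_mx g \in [seq translation_mx g | g : G].
    exact: map_f (mem_enum _ _).
  case/diagonalizable_forPex => D /(simmxP Punit) PD.
  rewrite -mul_row_translation_mx PD mulmxK //.
  by rewrite mul_diag_mx !mxE eqxx mulr1n.
suff : P *m (\col_j x (e j)) = 0.
  move/(congr1 (mulmx (invmx P))); rewrite mulKmx // mulmx0 => /colP x0'.
  by apply/ffunP => g; have := x0' (e' g); rewrite !mxE e'K ffunE.
apply/colP => i; rewrite !mxE.
have Pd g : P i (e' g) = d i g * P i (e' 0) by rewrite -Dd add0r.
(* A row that vanishes at 0 vanishes everywhere. Otherwise its value at 0 can be cancelled, which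
   makes [d i] multiplicative. *)
have [P0|P0] := eqVneq (P i (e' 0)) 0.
  by apply: big1 => j _; rewrite -(eK j) Pd P0 mulr0 mul0r.
have /x0 : is_character (d i).
  apply: morph_character.
    move=> g h; apply: (mulIf P0); rewrite -Dd add0r Dd Pd.
    by rewrite mulrA [d i h * _]mulrC.
  by exists 0; have := Pd 0; rewrite -{1}[P i _]mul1r => /(mulIf P0) <-;
     rewrite oner_eq0.
rewrite /zeval (reindex e) /=; last by exists e' => ? _.
move=> xd0; under eq_bigr => j _.
  rewrite mxE -{1}(eK j) Pd mulrAC mulrC; over.
by rewrite -mulr_sumr; under eq_bigr do rewrite mulrC; rewrite xd0 mulr0.
Qed.

End Translations.

Lemma zeval_eq0 x : (forall gamma, is_character gamma -> zeval gamma x = 0) ->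
  x = 0.
Proof.
have : (0 < #|G|)%N by apply/card_gt0P; exists 0.
case En: #|G| => [//|n] _.
apply: (@zeval_eq0_enum n (enum_val \o cast_ord (esym En))
                         (cast_ord En \o enum_rank)).
  by move=> i; rewrite /= enum_valK cast_ordKV.
by move=> g; rewrite /= cast_ordK enum_rankK.
Qed.

(** * Coefficients, conjugation and evaluation in the group algebra *)

Lemma zsumE g : zsum C G g = 1.
Proof.
rewrite sum_ffunE (bigD1 g) //= ffunE eqxx big1 ?addr0 // => h /negbTE gh.
by rewrite ffunE eq_sym gh.
Qed.

Lemma zmon_mulE h x g : (zmon C h * x) g = x (g - h).
Proof.
rewrite ffunE (bigD1 h) //= ffunE eqxx mul1r big1 ?addr0 // => l /negbTE lh.
by rewrite ffunE lh mul0r.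
Qed.

Lemma zmon_inj : injective (@zmon C G).
Proof.
move=> g h /ffunP/(_ g); rewrite !ffunE eqxx.
by case: eqP => // _ /eqP; rewrite oner_eq0.
Qed.

Lemma zmon_neq0 g : zmon C g != 0.
Proof.
by apply/eqP => /ffunP/(_ g)/eqP; rewrite !ffunE eqxx oner_eq0.
Qed.

Lemma zconj0 : zconj (0 : grpalg C G) = 0.
Proof. by apply/ffunP => g; rewrite !ffunE rmorph0. Qed.

Lemma zconjD x y : zconj (x + y) = zconj x + zconj y.
Proof. by apply/ffunP => g; rewrite !ffunE rmorphD. Qed.

Lemma zconjN x : zconj (- x) = - zconj x.
Proof. by apply/ffunP => g; rewrite !ffunE rmorphN. Qed.

Lemma zconjK : involutive (@zconj C G).
Proof. by move=> x; apply/ffunP => g; rewrite !ffunE opprK conjCK. Qed.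

Lemma zconjM x y : zconj (x * y) = zconj x * zconj y.
Proof.
apply/ffunP => g; rewrite !ffunE rmorph_sum (reindex_inj oppr_inj) /=.
by apply: eq_bigr => h _; rewrite !ffunE rmorphM opprB opprK addrC.
Qed.

Lemma zconj_nat n : zconj (n%:R : grpalg C G) = n%:R.
Proof.
elim: n => [|n IHn]; first exact: zconj0.
by rewrite mulrS zconjD IHn [zconj 1]zconj_zmon oppr0.
Qed.

Lemma zconj_sum (I : Type) (s : seq I) (P : pred I) (F : I -> grpalg C G) :
  zconj (\sum_(i <- s | P i) F i) = \sum_(i <- s | P i) zconj (F i).
Proof. exact: (big_morph _ zconjD zconj0). Qed.

Lemma zmon_mul_zsum g : zmon C g * zsum C G = zsum C G.
Proof. by apply/ffunP => h; rewrite zmon_mulE !zsumE. Qed.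

Section Evaluation.
Variable gamma : G -> C.

Lemma zevalD x y : zeval gamma (x + y) = zeval gamma x + zeval gamma y.
Proof.
by rewrite /zeval -big_split; apply: eq_bigr => g _; rewrite ffunE mulrDl.
Qed.

Lemma zeval0 : zeval gamma (0 : grpalg C G) = 0.
Proof. by rewrite /zeval big1 // => g _; rewrite ffunE mul0r. Qed.

Lemma zevalZ a x : zeval gamma (a *: x) = a * zeval gamma x.
Proof.
by rewrite /zeval mulr_sumr; apply: eq_bigr => g _; rewrite ffunE -mulrA.
Qed.

Lemma zevalN x : zeval gamma (- x) = - zeval gamma x.
Proof. by rewrite -scaleN1r zevalZ mulN1r. Qed.

Lemma zeval_sum (I : Type) (s : seq I) (P : pred I) (F : I -> grpalg C G) :
  zeval gamma (\sum_(i <- s | P i) F i) = \sum_(i <- s | P i) zeval gamma (F i).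
Proof. exact: (big_morph _ zevalD zeval0). Qed.

Lemma zeval_zmon g : zeval gamma (zmon C g) = gamma g.
Proof.
rewrite /zeval (bigD1 g) //= ffunE eqxx mul1r big1 ?addr0 // => h /negbTE hg.
by rewrite ffunE hg mul0r.
Qed.

Hypothesis gc : is_character gamma.

Lemma zevalM x y : zeval gamma (x * y) = zeval gamma x * zeval gamma y.
Proof.
rewrite /zeval big_distrl /=; under eq_bigr => g _ do rewrite ffunE mulr_suml.
rewrite exchange_big /=; apply: eq_bigr => h _.
rewrite mulr_sumr (reindex_inj (addIr h)) /=; apply: eq_bigr => g _.
by rewrite addrK gc.1 [RHS]mulrACA [gamma h * _]mulrC.
Qed.

Lemma zeval_nat n : zeval gamma (n%:R : grpalg C G) = n%:R.
Proof.
by rewrite -scaler_nat zevalZ [zeval _ 1]zeval_zmon character0 ?mulr1.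
Qed.

Lemma zeval_zconj x : zeval gamma (zconj x) = (zeval gamma x)^*.
Proof.
rewrite /zeval rmorph_sum (reindex_inj oppr_inj) /=; apply: eq_bigr => g _.
by rewrite !ffunE opprK characterN // rmorphM.
Qed.

Lemma peval_mul m n p (A : 'M[grpalg C G]_(m, n)) (A' : 'M_(n, p)) :
  peval gamma (A *m A') = peval gamma A *m peval gamma A'.
Proof.
apply/matrixP => i j; rewrite !mxE zeval_sum; apply: eq_bigr => l _.
by rewrite zevalM !mxE.
Qed.

Lemma peval_padj m n (A : 'M[grpalg C G]_(m, n)) :
  peval gamma (padj A) = (map_mx Num.conj (peval gamma A))^T.
Proof. by apply/matrixP => i j; rewrite !mxE zeval_zconj. Qed.

End Evaluation.

Lemma character_trivialVnontrivial gamma : is_character gamma ->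
  (forall g, gamma g = 1) \/ nontrivial_character gamma.
Proof.
move=> gc; have [/forallP g1|] := boolP [forall g, gamma g == 1].
  by left=> g; apply/eqP.
by rewrite negb_forall => /existsP[g gP]; right; split=> //; exists g.
Qed.

(** Multiplication by [z^g] fixes 1(z) but scales its value by [gamma g], which differs from 1 for
    some [g]. *)
Lemma zeval_zsum gamma : nontrivial_character gamma ->
  zeval gamma (zsum C G) = 0.
Proof.
case=> gc [g g1]; have /eqP := congr1 (zeval gamma) (zmon_mul_zsum g).
rewrite zevalM // zeval_zmon -subr_eq0 -{2}[zeval _ _]mul1r -mulrBl mulf_eq0.
by rewrite subr_eq0 (negbTE g1) => /eqP.
Qed.

(* [(z^g - 1) x] vanishes at every character, so [x] is invariant under
   translations. *)
Lemma zeval_nontrivial_eq0 x :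
  (forall gamma, nontrivial_character gamma -> zeval gamma x = 0) ->
  x = x 0 *: zsum C G.
Proof.
move=> x0; apply/ffunP => g; rewrite ffunE zsumE [_ *: 1]mulr1.
suff /ffunP/(_ 0) : zmon C (- g) * x - x = 0.
  by rewrite [in LHS]ffunE zmon_mulE opprK add0r !ffunE => /subr0_eq.
apply: zeval_eq0 => gamma gc; rewrite zevalD zevalN zevalM // zeval_zmon.
have [->|/x0->] := character_trivialVnontrivial gc; last by rewrite mulr0 subrr.
by rewrite mul1r subrr.
Qed.

(* A character detecting [z^0 - z^g0] summed over [2G], with [g0] outside
   [2G], must be trivial on [2G]. *)
Lemma exists_real_character : ~~ odd #|G| ->
  exists2 gamma : G -> C, nontrivial_character gamma &
    forall g, gamma g \is Num.real.
Proof.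
rewrite -dvdn2 -cardsT => /(@Cauchy _ 2 _ isT)[t _ ot].
have t2 : t + t = 0 by have := expg_order t; rewrite ot.
have t0 : t != 0 by apply/eqP => t0; have := ot; rewrite t0 order1.
(* Doubling sends both 0 and the involution [t] to 0, so on a finite group it is not surjective. *)
have [g0 g0P] : exists g0, g0 \notin [seq g + g | g : G].
  apply/existsP; rewrite -negb_forall; apply/negP => /forallP surj.
  have /image_injP inj2 : #|[seq g + g | g : G]| == #|G|.
    by apply/eqP/eq_card => g; rewrite surj.
  by have := inj2 t 0 isT isT; rewrite t2 addr0 => /(_ erefl)/eqP;
     rewrite (negbTE t0).
pose x := \sum_(g : G) zmon C (g + g); pose y := x - zmon C g0 * x.
have xE g : x g = #|[pred h : G | h + h == g]|%:R.
  rewrite sum_ffunE -sum1_card natr_sum [RHS]big_mkcond /=.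
  by apply: eq_bigr => h _; rewrite ffunE inE eq_sym; case: eqP.
(* The coefficient of [y] at [g0] is [x g0 - x 0]: nothing doubles to [g0], whereas 0 doubles to
   0. *)
have y0 : y <> 0.
  move=> /ffunP/(_ g0); rewrite ffunE ffunE zmon_mulE subrr !xE ffunE.
  rewrite eq_card0 => [|h]; last first.
    rewrite !inE; apply: contraNF g0P => /eqP <-; exact: map_f (mem_enum _ _).
  move/eqP; rewrite add0r oppr_eq0 pnatr_eq0 => /eqP/card0_eq/(_ 0).
  by rewrite !inE addr0 eqxx.
have [gamma [gc gy]] : exists gamma : G -> C,
    is_character gamma /\ zeval gamma y != 0.
  apply: contrapT => no_gamma; apply: y0; apply: zeval_eq0 => gamma gc.
  by apply/eqP; apply: contrapT => /negP gy; apply: no_gamma; exists gamma.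
have : zeval gamma y = (1 - gamma g0) * zeval gamma x.
  by rewrite zevalD zevalN zevalM // zeval_zmon mulrBl mul1r.
move=> yE; move: gy; rewrite yE mulf_eq0 negb_or subr_eq0 eq_sym.
case/andP=> g01 gx.
exists gamma; first by split=> //; exists g0.
(* Since [x] is invariant under translation by doubles and has nonzero value at [gamma], each
   [gamma g] squares to 1. *)
move=> g; have : zmon C (g + g) * x = x.
  rewrite mulr_sumr [RHS](reindex_inj (addrI g)) /=; apply: eq_bigr => h _.
  by rewrite -zmonD addrACA.
move/(congr1 (zeval gamma)); rewrite zevalM // zeval_zmon -[RHS]mul1r.
move/(mulIf gx).
rewrite gc.1 -expr2 => /eqP; rewrite sqrf_eq1.
by case/orP=> /eqP->; rewrite ?rpredN rpred1.
Qed.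

End Characters.

(** * Counting in block designs with one block through each pair *)

Section BIBD.
Variables (b v k : nat) (B : 'I_b -> {set 'I_v}).
Hypothesis BP : is_BIBD1 k B.

Lemma BIBD_block_unique i1 i2 j1 j2 : j1 != j2 ->
  j1 \in B i1 -> j2 \in B i1 -> j1 \in B i2 -> j2 \in B i2 -> i1 = i2.
Proof.
case: BP => _ _ _ pairB /pairB/eqP/cards1P[i0 /setP Bi0].
move=> Bi1j1 Bi1j2 Bi2j1 Bi2j2.
have := Bi0 i1; rewrite !inE Bi1j1 Bi1j2 => /esym/eqP ->.
by have := Bi0 i2; rewrite !inE Bi2j1 Bi2j2 => /esym/eqP ->.
Qed.

Lemma BIBD_block_exists j1 j2 : j1 != j2 ->
  exists2 i, j1 \in B i & j2 \in B i.
Proof.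
case: BP => _ _ _ pairB /pairB/eqP/cards1P[i0 /setP/(_ i0)].
by rewrite !inE eqxx => /andP[]; exists i0.
Qed.

(** The replication number, that is, the number of blocks through any vertex; the division turns out
    to be exact. *)
Definition BIBD_rep : nat := v.-1 %/ k.-1.

(** Double count the pairs of a vertex other than [j] and a block containing it and [j]: each such
    vertex has one block, and each block through [j] has [k.-1] such vertices. *)
Lemma BIBD_rep_mul j : (#|[set i | j \in B i]| * k.-1 = v.-1)%N.
Proof.
case: BP => _ _ sizeB pairB.
have <- : #|[set~ j]| = v.-1 by rewrite cardsC1 card_ord.
transitivity (\sum_(j' in [set~ j]) \sum_(i | (j \in B i) && (j' \in B i)) 1)%N;
  last first.
  rewrite -sum1_card; apply: eq_bigr => j'; rewrite !inE eq_sym => /pairB.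
  by rewrite sum1dep_card.
rewrite (exchange_big_dep (fun i => j \in B i)) => [|? ? _ /andP[]//] /=.
rewrite -sum_nat_const; under eq_bigl => i do rewrite inE.
apply: eq_bigr => i Bij; rewrite sum1dep_card.
rewrite -(sizeB i) (cardsD1 j (B i)) Bij /=.
by apply: eq_card => j'; rewrite !inE.
Qed.

Lemma card_BIBD_rep j : #|[set i | j \in B i]| = BIBD_rep.
Proof.
case: BP => k2 _ _ _.
by rewrite /BIBD_rep -(BIBD_rep_mul j) mulnK // -subn1 subn_gt0.
Qed.

Lemma BIBD_repM : (BIBD_rep * k.-1 = v.-1)%N.
Proof.
case: BP => k2 kv _ _; have v0 : (0 < v)%N by apply: leq_trans kv.
by rewrite -(card_BIBD_rep (Ordinal v0)) BIBD_rep_mul.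
Qed.

Lemma BIBD_rep_gt1 : (1 < BIBD_rep)%N.
Proof.
case: BP => k2 kv _ _; have k1 : (0 < k.-1)%N by rewrite -subn1 subn_gt0.
rewrite -(ltn_pmul2r k1) BIBD_repM mul1n -!subn1 ltn_sub2r //.
exact: leq_trans (ltnW kv).
Qed.

Lemma BIBD_rep_div (F : numFieldType) :
  (v%:R - 1) / (k%:R - 1) = BIBD_rep%:R :> F.
Proof.
case: BP => k2 kv _ _.
have k1 : k%:R - 1 = k.-1%:R :> F by rewrite -subn1 natrB // ltnW.
have -> : v%:R - 1 = v.-1%:R :> F by rewrite -subn1 natrB // (leq_trans _ kv).
rewrite k1 -BIBD_repM natrM mulfK // pnatr_eq0 -lt0n -subn1 subn_gt0 //.
Qed.

(** Supplies a zero entry of the polyphase matrix, without which condition (iii) would say nothing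
    about [k / f]. *)
Lemma BIBD_nonincident : exists i j, j \notin B i.
Proof.
case: BP => k2 kv sizeB _.
have v2 : (1 < v)%N by apply: leq_trans k2 (ltnW kv).
have [i _ _] : exists2 i, Ordinal (ltnW v2) \in B i & Ordinal v2 \in B i.
  exact: BIBD_block_exists.
have /set0Pn[j] : ~: B i != finset.set0.
  by rewrite -card_gt0 cardsCs setCK card_ord sizeB subn_gt0.
by rewrite inE; exists i, j.
Qed.

End BIBD.

(** * Tight frames and the matrix identity M M^* M = a M *)

Section TightFrames.
Variable C : numClosedFieldType.
Local Notation adjmx M := (map_mx Num.conj M)^T.

Lemma synthesis_analysis m n (M : 'M[C]_(m, n)) (x : 'cV_m) :
  \sum_i inner (col i M) x *: col i M = M *m adjmx M *m x.
Proof.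
rewrite -mulmxA; apply/colP => l; rewrite summxE mxE; apply: eq_bigr => i _.
rewrite !mxE mulrC; congr (_ * _); apply: eq_bigr => l' _.
by rewrite !mxE.
Qed.

Lemma gramE m n (M : 'M[C]_(m, n)) i j :
  inner (col i M) (col j M) = (adjmx M *m M) i j.
Proof. by rewrite mxE; apply: eq_bigr => l _; rewrite !mxE. Qed.

Lemma columns_ETF_cube m n (M : 'M[C]_(m, n)) : columns_ETF M ->
  exists a, M *m adjmx M *m M = a *: M.
Proof.
case=> _ _ _ [a _ aP]; exists a; apply/matrixP => i j.
have := aP (col j M); rewrite memv_span ?codom_f // => /(_ isT) /colP/(_ i).
by rewrite synthesis_analysis colE mulmxA scalemxAl -!colE [LHS]mxE [RHS]mxE.
Qed.

(** The Gram matrix gives equal norms and equiangularity. Vectors of the span have the form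
    [M *m y], so the cube identity extends tightness from the columns to all of them. *)
Lemma cube_columns_ETF m n (M : 'M[C]_(m, n)) (s w a : C) :
    s != 0 -> 0 < a -> (forall j, (adjmx M *m M) j j = s) ->
    (forall i j, i != j -> `|(adjmx M *m M) i j| = w) ->
    M *m adjmx M *m M = a *: M ->
  columns_ETF M.
Proof.
move=> s0 a0 diagM offM cubeM; split.
- move=> i; apply: contraNneq s0 => ci0; rewrite -(diagM i) -gramE ci0.
  by rewrite /inner big1 // => l _; rewrite mxE mulr0.
- by move=> i j; rewrite /vnorm !gramE !diagM.
- by exists w => i j /offM; rewrite gramE.
exists a => // x; rewrite synthesis_analysis => xM.
have [y ->] : exists y : 'cV_n, x = M *m y.
  move: xM; rewrite span_def big_image => /memv_sumP[us usM ->].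
  apply: (big_ind (fun x => exists y, x = M *m y))
    => [|_ _ [y1 ->] [y2 ->]|j _].
  - by exists 0; rewrite mulmx0.
  - by exists (y1 + y2); rewrite mulmxDr.
  - have /vlineP[c ->] := usM j isT.
    by exists (c *: delta_mx j 0); rewrite -scalemxAr -colE.
by rewrite mulmxA cubeM scalemxAl.
Qed.

End TightFrames.

(** Under the two relations [v - c - 2] equals [s - r]. In the application [s] is k - 1 and [c] is
    the product of the last two DRACKN parameters. *)
Lemma sqr_sub_scalar_mx (T : comNzRingType) n (M K : 'M[T]_n) (r s v c : T) :
    M *m M = (r + s) *: M + K -> v = r * s + 1 -> c = (s + 1) * (r - 1) ->
  (M - r%:M) *m (M - r%:M)
  = (v - c - 2%:R) *: (M - r%:M) + (v - 1)%:M + K.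
Proof.
move=> M2 -> ->.
have -> : (M - r%:M) *m (M - r%:M) = M *m M - r *: M - r *: M + (r * r)%:M.
  rewrite mulmxBl !mulmxBr mul_scalar_mx mul_mx_scalar mul_scalar_mx.
  by rewrite scale_scalar_mx opprB addrA [RHS]addrAC.
rewrite M2; apply/matrixP => i j; rewrite !mxE.
by case: eqP => _; rewrite ?mulr1n ?mulr0n; ring.
Qed.

(** * The triple product and the Gram matrix of a polyphase matrix over a block design *)

Section PolyphaseBIBD.
Variables (C : numClosedFieldType) (G : finZmodType) (b v k : nat).
Variables (Phi : 'M[grpalg C G]_(b, v)) (B : 'I_b -> {set 'I_v}).
Hypothesis hPhi : monomial_or_zero Phi.
Hypothesis BP : is_BIBD1 k B.
Hypothesis absPhi : forall i j, zconj (Phi i j) * Phi i j = (j \in B i)%:R.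
Local Notation r := (BIBD_rep v k).
Local Notation cube := (Phi *m padj Phi *m Phi).
Local Notation gram := (padj Phi *m Phi).

Lemma is_zmonM (x y : grpalg C G) : is_zmon x -> is_zmon y -> is_zmon (x * y).
Proof. by case=> g -> [h ->]; exists (g + h); rewrite zmonD. Qed.

Lemma is_zmon_zconj (x : grpalg C G) : is_zmon x -> is_zmon (zconj x).
Proof. by case=> g ->; exists (- g); rewrite zconj_zmon. Qed.

Lemma polyphase_eq0 i j : (Phi i j == 0) = (j \notin B i).
Proof.
have := absPhi i j; have [->|[g ->]] := hPhi i j.
  by rewrite mulr0 eqxx; case: (_ \in _) => // /esym/eqP; rewrite oner_eq0.
rewrite zconj_zmon -zmonD addNr (negbTE (zmon_neq0 _ _)).
by case: (_ \in _) => // /eqP; rewrite (negbTE (zmon_neq0 _ _)).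
Qed.

Lemma polyphase_out i j : j \notin B i -> Phi i j = 0.
Proof. by rewrite -polyphase_eq0 => /eqP. Qed.

Lemma polyphase_zmon i j : j \in B i -> is_zmon (Phi i j).
Proof.
have [/eqP|//] := hPhi i j; by rewrite polyphase_eq0 => /negbTE->.
Qed.

Definition polyphase_term i j i' j' := Phi i j' * zconj (Phi i' j') * Phi i' j.

Lemma cubeE i j : cube i j = \sum_i' \sum_j' polyphase_term i j i' j'.
Proof.
rewrite mxE; apply: eq_bigr => i' _; rewrite mxE mulr_suml.
by apply: eq_bigr => j' _; rewrite !mxE.
Qed.

Lemma polyphase_term0 i j i' j' :
  ~~ [&& j' \in B i, j' \in B i' & j \in B i'] -> polyphase_term i j i' j' = 0.
Proof.
rewrite /polyphase_term.
have [ij'|/polyphase_out->] := boolP (j' \in B i); last by rewrite !mul0r.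
have [i'j'|/polyphase_out->] := boolP (j' \in B i'); last first.
  by rewrite zconj0 mulr0 mul0r.
by rewrite andTb => /polyphase_out->; rewrite mulr0.
Qed.

Lemma polyphase_term_zmon i j i' j' :
  [&& j' \in B i, j' \in B i' & j \in B i'] ->
  is_zmon (polyphase_term i j i' j').
Proof.
case/and3P=> /polyphase_zmon ? /polyphase_zmon ? /polyphase_zmon ?.
by do !apply: is_zmonM => //; apply: is_zmon_zconj.
Qed.

(* For [j] in block [i], the blocks through [j] and a second point [j'] of
   block [i] reduce to [i] itself, so only the terms with [i' = i] or [j' = j]
   survive, and each of them equals [Phi i j]. *)
Lemma cube_in i j : j \in B i -> cube i j = (r + k.-1)%:R * Phi i j.
Proof.
move=> Bij; have [k2 _ sizeB _] := BP.
rewrite cubeE (bigD1 i) //=.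
have -> : \sum_j' polyphase_term i j i j' = k%:R * Phi i j.
  rewrite -(sizeB i) -sum1_card natr_sum mulr_suml [RHS]big_mkcond /=.
  apply: eq_bigr => j' _; rewrite /polyphase_term [Phi i j' * _]mulrC absPhi.
  by case: (_ \in _); rewrite ?mul0r.
have -> : \sum_(i' | i' != i) \sum_j' polyphase_term i j i' j' =
    r.-1%:R * Phi i j.
  rewrite -(card_BIBD_rep BP j) (cardsD1 i) inE Bij /= -sum1_card natr_sum.
  rewrite mulr_suml big_mkcond [RHS]big_mkcond; apply: eq_bigr => i' _.
  rewrite !inE; have [//|i'i] /= := eqVneq i' i.
  rewrite (bigD1 j) //= big1 ?addr0 => [|j' j'j].
    by rewrite /polyphase_term -mulrA absPhi mulrC;
       case: (_ \in _); rewrite ?mul0r.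
  apply: polyphase_term0; apply: contraNN i'i => /and3P[ij' i'j' i'j].
  by rewrite (BIBD_block_unique BP j'j i'j' i'j ij' Bij).
rewrite -mulrDl -natrD; congr (_%:R * _).
have := BIBD_rep_gt1 BP; case: (r) => // r' _; case: k k2 => //= k' _.
by rewrite !addSn addnC.
Qed.

(** At the trivial character each nonzero term counts 1. Each of the [k] points [j'] of block [i]
    differs from [j], so exactly one block [i'] through both contributes. *)
Lemma zeval1_cube_out i j : j \notin B i ->
  zeval (fun=> 1) (cube i j) = k%:R.
Proof.
move=> Bij; have [_ _ sizeB _] := BP.
have z1 (x : grpalg C G) : is_zmon x -> zeval (fun=> 1) x = 1.
  by case=> g ->; rewrite zeval_zmon.
rewrite cubeE exchange_big zeval_sum -(sizeB i) -sum1_card natr_sum.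
rewrite [RHS]big_mkcond; apply: eq_bigr => j' _ /=; case: ifPn => Bij';
  last first.
  by rewrite big1 ?zeval0 // => i' _; apply: polyphase_term0;
     rewrite (negbTE Bij').
have j'j : j' != j by apply: contraNneq Bij => <-.
have [i0 i0j' i0j] := BIBD_block_exists BP j'j.
rewrite (bigD1 i0) //= big1 ?addr0 => [|i' i'i0].
  by apply: z1; apply: polyphase_term_zmon; apply/and3P.
apply: polyphase_term0; apply: contraNN i'i0 => /and3P[_ i'j' i'j].
by rewrite (BIBD_block_unique BP j'j i'j' i'j i0j' i0j).
Qed.

Lemma gram_diag j : gram j j = r%:R.
Proof.
rewrite mxE -(card_BIBD_rep BP j) -sum1_card natr_sum [RHS]big_mkcond /=.
by apply: eq_bigr => i _; rewrite !mxE absPhi inE; case: (_ \in _).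
Qed.

(** Only the unique block through both vertices contributes to the sum. *)
Lemma gram_off j1 j2 : j1 != j2 -> is_zmon (gram j1 j2).
Proof.
move=> j12; have [i0 i0j1 i0j2] := BIBD_block_exists BP j12.
rewrite mxE (bigD1 i0) //= big1 ?addr0 => [|i ii0].
  rewrite !mxE.
  by apply: is_zmonM; [apply: is_zmon_zconj|]; apply: polyphase_zmon.
rewrite !mxE; have [ij1|/polyphase_out->] := boolP (j1 \in B i); last first.
  by rewrite zconj0 mul0r.
rewrite (polyphase_out (i := i) (j := j2)) ?mulr0 //.
apply: contraNN ii0 => ij2.
by rewrite (BIBD_block_unique BP j12 ij1 ij2 i0j1 i0j2).
Qed.

(** At a nontrivial character the cube is a multiple of [Phi(gamma)], whose entry here is 0. The
    entry is therefore a multiple of 1(z), and the trivial character fixes the multiple. *)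
Lemma columns_ETF_cube_out i j : j \notin B i ->
    (forall gamma : G -> C, nontrivial_character gamma ->
       columns_ETF (peval gamma Phi)) ->
  cube i j = (k%:R / #|G|%:R) *: zsum C G.
Proof.
move=> Bij etf.
have Dc : cube i j = cube i j 0 *: zsum C G.
  apply: zeval_nontrivial_eq0 => gamma gnt; have [gc _] := gnt.
  have [a /matrixP/(_ i j)] := columns_ETF_cube (etf _ gnt).
  rewrite -peval_padj // -!peval_mul // mxE => ->.
  by rewrite !mxE (polyphase_out Bij) zeval0 mulr0.
have G0 : #|G|%:R != 0 :> C.
  by rewrite pnatr_eq0 -lt0n; apply/card_gt0P; exists 0.
rewrite Dc; congr (_ *: _); apply: (mulIf G0); rewrite divfK //.
rewrite -(zeval1_cube_out Bij) [in RHS]Dc zevalZ; congr (_ * _).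
by rewrite /zeval; under eq_bigr do rewrite zsumE mulr1; rewrite sumr_const.
Qed.

(** Multiples of 1(z) vanish at [gamma], so the cube identity holds with frame constant r + k - 1.
    The multiples are left unspecified so that constant counts, as in (iv), suffice. *)
Lemma cube_out_columns_ETF gamma : nontrivial_character gamma ->
    (forall i j, j \notin B i -> cube i j = cube i j 0 *: zsum C G) ->
  columns_ETF (peval gamma Phi).
Proof.
move=> gnt hout; have [gc _] := gnt.
have r0 : (0 < r)%N := ltnW (BIBD_rep_gt1 BP).
apply: (@cube_columns_ETF _ _ _ _ r%:R 1 (r + k.-1)%:R).
- by rewrite pnatr_eq0 -lt0n.
- by rewrite ltr0n addn_gt0 r0.
- by move=> j; rewrite -peval_padj // -peval_mul // mxE gram_diag zeval_nat.
- move=> j1 j2 /gram_off[g gE]; rewrite -peval_padj // -peval_mul // mxE gE.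
  by rewrite zeval_zmon gc.2.
rewrite -peval_padj // -!peval_mul //; apply/matrixP => i j; rewrite [LHS]mxE.
rewrite [RHS]mxE [in RHS]mxE; have [/cube_in->|Bij] := boolP (j \in B i).
  by rewrite zevalM // zeval_nat.
by rewrite hout // zevalZ zeval_zsum // (polyphase_out Bij) zeval0 !mulr0.
Qed.

(** Each term of the double sum is a monomial or zero, so a coefficient of the sum counts the terms
    equal to that monomial. *)
Lemma cube_coef i j g :
  cube i j g = #|[set p : 'I_b * 'I_v |
     zmon C g == Phi i p.2 * zconj (Phi p.1 p.2) * Phi p.1 j]|%:R.
Proof.
rewrite cubeE pair_big sum_ffunE -sum1_card natr_sum [RHS]big_mkcond /=.
apply: eq_bigr => -[i' j'] _; rewrite inE /= -/(polyphase_term i j i' j').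
have [/polyphase_term_zmon[h ->]|/polyphase_term0->] :=
    boolP [&& j' \in B i, j' \in B i' & j \in B i'].
  by rewrite ffunE (inj_eq (@zmon_inj _ _)); case: eqP.
by rewrite ffunE (negbTE (zmon_neq0 _ _)).
Qed.

Lemma cube_matrixE (t : grpalg C G) :
  (forall i j, j \notin B i -> cube i j = t) ->
  cube = (r + k.-1)%:R *: Phi + t *: (const_mx 1 - abs2mx Phi).
Proof.
move=> hout; apply/matrixP => i j; rewrite [RHS]mxE.
rewrite ![in RHS]mxE absPhi; have [Bij|Bij] := boolP (j \in B i).
  by rewrite subrr mulr0 addr0 cube_in.
by rewrite hout // (polyphase_out Bij) mulr0 add0r subr0 mulr1.
Qed.

(** 1(z) absorbs monomials, so each entry counts the blocks through [j1] that avoid [j2]: none if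
    they coincide, otherwise all but one of the r blocks through [j1]. *)
Lemma padj_abs2mx_compl :
  padj Phi *m (zsum C G *: (const_mx 1 - abs2mx Phi))
  = ((r.-1)%:R * zsum C G) *: (const_mx 1 - 1%:M).
Proof.
have r0 : (0 < r)%N := ltnW (BIBD_rep_gt1 BP).
apply/matrixP => j1 j2; rewrite [LHS]mxE.
have zP i : padj Phi j1 i * (zsum C G *: (const_mx 1 - abs2mx Phi)) i j2
    = ((j1 \in B i) && (j2 \notin B i))%:R * zsum C G.
  rewrite !mxE absPhi.
  have [Bi|/polyphase_out->] := boolP (j1 \in B i); last first.
    by rewrite zconj0 !mul0r.
  have [g ->] := is_zmon_zconj (polyphase_zmon Bi).
  rewrite mulrA zmon_mul_zsum mulrC.
  by case: (_ \in _); rewrite ?subrr ?subr0.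
under eq_bigr do rewrite zP.
rewrite -mulr_suml -natr_sum -big_mkcond sum1dep_card !mxE.
have [<-|j12] := eqVneq j1 j2.
  by rewrite subrr mulr0 eq_card0 ?mul0r // => i; rewrite inE andbN.
have [_ _ _ pairB] := BP; move: (pairB _ _ j12) => {}pairB.
rewrite subr0 mulr1 -(card_BIBD_rep BP j1).
rewrite -(cardsID [set i | j2 \in B i] [set i | j1 \in B i]).
have -> : #|[set i | j1 \in B i] :&: [set i | j2 \in B i]| = 1%N.
  by rewrite -[RHS]pairB; apply: eq_card => i; rewrite !inE.
by congr (_%:R * _); apply: eq_card => i; rewrite !inE andbC.
Qed.

Lemma padj_gram : padj gram = gram.
Proof.
apply/matrixP => i j; rewrite !mxE zconj_sum; apply: eq_bigr => l _.
by rewrite !mxE zconjM zconjK mulrC.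
Qed.

Lemma padj_gramB_scalar n : padj (gram - (n%:R)%:M) = gram - (n%:R)%:M.
Proof.
rewrite -[in RHS]padj_gram; apply/matrixP => i j.
rewrite [LHS]mxE [in LHS]mxE [RHS]mxE [X in _ = X + _]mxE [X in _ = X + _]mxE.
rewrite mxE zconjD; congr (_ + _); rewrite !mxE zconjN eq_sym.
by case: (_ == _); rewrite ?mulr0n ?mulr1n ?zconj0 ?zconj_nat.
Qed.

(** Multiplying the cube identity on the left by Phi^* gives a quadratic equation for the Gram
    matrix; shifting by its diagonal r yields the DRACKN equation. *)
Lemma shifted_gram_sqr (N : nat) : k = (N * #|G|)%N ->
    (forall i j, j \notin B i -> cube i j = N%:R *: zsum C G) ->
  let A := gram - (r%:R)%:M in
  A *m A = (v%:R - #|G|%:R * (N * r.-1)%:R - 2%:R) *: A + (v%:R - 1)%:M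
           + ((N * r.-1)%:R * zsum C G) *: (const_mx 1 - 1%:M).
Proof.
move=> kN hout A; have [k2 kv _ _] := BP.
have gram2 : gram *m gram = (r + k.-1)%:R *: gram
    + ((N * r.-1)%:R * zsum C G) *: (const_mx 1 - 1%:M).
  rewrite -mulmxA [Phi *m _]mulmxA (cube_matrixE hout) mulmxDr -scalemxAr.
  congr (_ + _); rewrite scaler_nat -[zsum C G *+ N]mulr_natl -[in LHS]scalerA.
  rewrite -scalemxAr.
  by rewrite padj_abs2mx_compl scalerA natrM mulrA.
have vE : v%:R = r%:R * k.-1%:R + 1 :> grpalg C G.
  by rewrite -natrM (BIBD_repM BP) natr1 prednK // (leq_trans _ kv).
have NG : #|G|%:R * (N * r.-1)%:R = (k.-1%:R + 1) * (r%:R - 1) :> grpalg C G.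
  rewrite -natrM mulnA [(#|G| * N)%N]mulnC -kN natrM natr1 prednK ?(ltnW k2) //.
  by rewrite -subn1 natrB // ltnW // (BIBD_rep_gt1 BP).
apply: (sqr_sub_scalar_mx (s := k.-1%:R)) => //.
by rewrite gram2 natrD.
Qed.

End PolyphaseBIBD.

Theorem theorem4p2 (R : realType) (G : finZmodType) (f v k b : nat)
    (Phi : 'M[grpalg R[i] G]_(b, v))
    (hG : #|G| = f) (hf : (2 <= f)%N) (hk : (2 <= k)%N) (hkv : (k < v)%N)
    (hPhi : monomial_or_zero Phi)
    (hX : is_BIBD1_incidence k (abs2mx Phi)) :
  let X := abs2mx Phi in
  let r : R[i] := (v%:R - 1) / (k%:R - 1) in
  let J : 'M[grpalg R[i] G]_(b, v) := const_mx 1 in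
  [<-> is_polyphase_BIBD_ETF k f Phi;
       Phi *m padj Phi *m Phi
         = (r + k%:R - 1)%:A *: Phi
           + ((k%:R / f%:R : R[i]) *: zsum R[i] G) *: (J - X);
       forall (i : 'I_b) (j : 'I_v), Phi i j = 0 ->
         \sum_(i' < b) \sum_(j' < v) Phi i j' * zconj (Phi i' j') * Phi i' j
           = (k%:R / f%:R : R[i]) *: zsum R[i] G;
       forall (i : 'I_b) (j : 'I_v), Phi i j = 0 ->
         forall g h : G,
           #|[set p : 'I_b * 'I_v |
               zmon R[i] g == Phi i p.2 * zconj (Phi p.1 p.2) * Phi p.1 j]|
           = #|[set p : 'I_b * 'I_v |
               zmon R[i] h == Phi i p.2 * zconj (Phi p.1 p.2) * Phi p.1 j]|]
  /\ (is_polyphase_BIBD_ETF k f Phi ->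
      [/\ (f %| k)%N,
          exists2 c : nat, c%:R = k%:R * (r - 1) / f%:R :> R[i]
            & is_abelian_DRACKN f c (padj Phi *m Phi - (r%:A)%:M)
        & ~~ odd f ->
          exists2 gamma : G -> R[i], nontrivial_character gamma
            & peval gamma Phi \is a mxOver Num.real
              /\ columns_ETF (peval gamma Phi)]).
Proof.
move=> X r J; have [B BP BX] := hX.
have absPhi i j : zconj (Phi i j) * Phi i j = (j \in B i)%:R.
  by have /matrixP/(_ i j) := BX; rewrite !mxE.
have rE : r = (BIBD_rep v k)%:R by exact: BIBD_rep_div BP _.
have k0 : (0 < k)%N := ltnW hk.
have rk : (r + k%:R - 1)%:A = (BIBD_rep v k + k.-1)%:R :> grpalg R[i] G.
  by rewrite rE -addrA -[k%:R - 1](natrB _ k0) subn1 -natrD scaler_nat.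
have outP i j : Phi i j = 0 <-> j \notin B i.
  by rewrite -(polyphase_eq0 hPhi absPhi); split=> /eqP.
have sumE i j : \sum_(i' < b) \sum_(j' < v)
    Phi i j' * zconj (Phi i' j') * Phi i' j = (Phi *m padj Phi *m Phi) i j.
  by rewrite cubeE.
have cube1 : is_polyphase_BIBD_ETF k f Phi -> forall i j, j \notin B i ->
    (Phi *m padj Phi *m Phi) i j = (k%:R / f%:R : R[i]) *: zsum R[i] G.
  by case=> _ _ _ etf i j Bij;
     rewrite (columns_ETF_cube_out hPhi BP absPhi Bij etf) hG.
split.
  (* The cycle is (i) to (ii) to (iii) to (iv) and back to (i). *)
  tfae=> [/cube1 hout|hmx i j Pij|hsum i j Pij g h|hcard].
  - by rewrite rk; apply: (cube_matrixE hPhi BP absPhi hout).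
  - rewrite sumE hmx mxE [in X in X + _]mxE Pij mulr0 add0r !mxE Pij mulr0.
    by rewrite subr0 mulr1.
  - apply/eqP; rewrite -(eqr_nat R[i]) -!(cube_coef hPhi absPhi) -!sumE hsum //.
    by rewrite !ffunE !zsumE.
  - split=> // gamma gnt.
    (* Constant counts make all coefficients equal to the one at 0, so the entry is a multiple of
       1(z). *)
    apply: (cube_out_columns_ETF hPhi BP absPhi gnt) => i j /outP Pij.
    apply/ffunP => g; rewrite ffunE zsumE [_ *: 1]mulr1 !(cube_coef hPhi absPhi).
    by rewrite (hcard i j Pij g 0).
move=> etf; have hout := cube1 etf.
have [i0 [j0 Bij0]] := BIBD_nonincident BP.
have f0 : f%:R != 0 :> R[i] by rewrite pnatr_eq0 -lt0n ltnW.
(* At a zero entry, the coefficient of z^0 is a cardinality and also equals [k / f]; this makes the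
   quotient an integer. *)
have [N kN] : exists N, k = (N * f)%N.
  have /ffunP/(_ 0) := hout i0 j0 Bij0.
  rewrite ffunE zsumE [_ *: 1]mulr1 (cube_coef hPhi absPhi).
  set N := #|_| => NE; exists N.
  by apply/eqP; rewrite -(eqr_nat R[i]) natrM NE divfK.
have kfN : k%:R / f%:R = N%:R :> R[i] by rewrite kN natrM mulfK.
have r1 := BIBD_rep_gt1 BP.
split.
- by rewrite kN dvdn_mull.
(* With [N = k / f] this is k(r - 1)/f; it is positive because [k > 0] and [r > 1]. *)
- exists (N * (BIBD_rep v k).-1)%N.
    rewrite mulrAC kfN natrM rE -subn1 natrB // ltnW //.
  rewrite rE [_%:R%:A]scaler_nat; split.
  + split=> //; first exact: leq_ltn_trans hkv.
    by rewrite muln_gt0 -subn1 subn_gt0 r1 andbT; case: (N) kN k0 => // ->.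
  + exact: padj_gramB_scalar.
  + by move=> i; rewrite mxE (gram_diag BP absPhi) !mxE eqxx subrr.
  + move=> i j ij; rewrite mxE [X in _ + X]mxE [X in _ - X]mxE (negbTE ij) subr0.
    exact: (gram_off hPhi BP absPhi ij).
  rewrite -hG; apply: (shifted_gram_sqr hPhi BP absPhi); rewrite ?hG //.
  by move=> i j Bij; rewrite hout // kfN.
rewrite -hG => /(exists_real_character R[i])[gamma gnt greal].
exists gamma => //; split; last by case: etf => _ _ _; apply.
apply/mxOverP => i j; rewrite mxE.
by have [->|[g ->]] := hPhi i j; rewrite ?zeval0 ?rpred0 // zeval_zmon.
Qed.
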